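(* For every integer base $b\geq 2$ and every positive integer $n$, $$\sum_{0\leq k\leq \log_b n}\ \sum_{0<j<b}\left\{\frac{n+jb^k}{b^{k+1}}\right\}=(m+1)\frac{b-1}{2}-\frac{n}{b^{m+1}},$$ where the sums are over integers $k$ and $j$, $\{\cdot\}$ denotes the fractional part, and $m=\lfloor\log_b n\rfloor$ is the position of the leading digit in the $b$-ary expansion of $n$.
   Context: The fractional part is $\{x\}=x-\lfloor x\rfloor$. *)

(* Defs.v *)
From mathcomp Require Import all_boot all_order all_algebra.
From mathcomp Require Import all_classical all_reals all_analysis.

Set Implicit Arguments.
Unset Strict Implicit.
Unset Printing Implicit Defensive.

Import Order.TTheory GRing.Theory Num.Theory.
Local Open Scope ring_scope.

Definition frac_part {R : realType} (x : R) : R := x - (Num.floor x)%:~R.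

Definition log_base {R : realType} (b x : R) : R := ln x / ln b.

(* Main.v *)
(* For every real x, the sum over 0 <= j < b of {x + j/b} equals {b x} + (b-1)/2.
   With x = n / b^(k+1) the inner sum is {n/b^k} - {n/b^(k+1)} + (b-1)/2, so the
   outer sum telescopes; n is an integer and 0 <= n / b^(m+1) < 1. *)
Require Import Defs.
From mathcomp Require Import all_boot all_order all_algebra.
From mathcomp Require Import all_classical all_reals all_analysis.
From mathcomp Require Import ring.

Set Implicit Arguments.
Unset Strict Implicit.
Unset Printing Implicit Defensive.

Import Order.TTheory GRing.Theory Num.Theory.
Local Open Scope classical_set_scope.
Local Open Scope ring_scope.

(** Raising [q] by one drops the residue of [q] and gains that of [q + b], which is the same. *)
Lemma sum_modn_shift (b q : nat) :
  (\sum_(0 <= j < b) (q + j) %% b = \sum_(0 <= j < b) j)%N.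
Proof.
elim: q => [|q IHq].
  by apply: eq_big_nat => j /andP[_ ltjb]; rewrite add0n modn_small.
rewrite -IHq; case: b {IHq} => [|b]; first by rewrite !big_geq.
rewrite big_nat_recr //= [RHS]big_nat_recl //= addnC addn0 addSnnS modnDr.
by congr (_ + _)%N; apply: eq_bigr => j _; rewrite addSnnS.
Qed.

(** Division of [n] by [d] gives [n + j * d = (n %/ d + j) * d + n %% d]; reducing the factor of [d]
    modulo [b] changes this by a multiple of [b * d] and leaves a value below [b * d]. *)
Lemma modn_mulD (b d n j : nat) : (0 < b)%N -> (0 < d)%N ->
  ((n + j * d) %% (b * d) = (n %/ d + j) %% b * d + n %% d)%N.
Proof.
move=> b_gt0 d_gt0.
rewrite {1}(divn_eq n d) addnAC -mulnDl {1}(divn_eq (n %/ d + j) b).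
rewrite mulnDl -mulnA -addnA modnMDl modn_small //.
rewrite (@leq_trans (((n %/ d + j) %% b).+1 * d)) ?leq_mul2r ?ltn_mod ?b_gt0 ?orbT//.
by rewrite mulSn addnC ltn_add2r ltn_mod.
Qed.

(** With [d = b ^ k], these are the numerators of the inner sum over the common denominator
    [b ^ k.+1], with the term [j = 0] included. *)
Lemma sum_modn_mulD (b d n : nat) : (0 < b)%N -> (0 < d)%N ->
  (\sum_(0 <= j < b) (n + j * d) %% (b * d) = 'C(b, 2) * d + b * (n %% d))%N.
Proof.
move=> b_gt0 d_gt0; under eq_bigr do rewrite modn_mulD //.
rewrite big_split /= -big_distrl /= sum_modn_shift -bin2_sum.
by rewrite sum_nat_const_nat subn0.
Qed.

Lemma frac_part_divn (R : realType) (a d : nat) : (0 < d)%N ->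
  frac_part (a%:R / d%:R : R) = (a %% d)%:R / d%:R.
Proof.
move=> d_gt0; have d_gt0' : 0 < d%:R :> R by rewrite ltr0n.
have Ea : a%:R / d%:R = (a %/ d)%:R + (a %% d)%:R / d%:R :> R.
  by rewrite {1}(divn_eq a d) natrD natrM mulrDl mulfK ?gt_eqF.
rewrite /frac_part (@floor_def _ _ (Posz (a %/ d))).
  by rewrite Ea addrC addKr.
rewrite Ea rmorphD /= -pmulrn lerDl divr_ge0 ?ler0n //= ltrD2l.
by rewrite ltr_pdivrMr // mul1r ltr_nat ltn_mod.
Qed.

Lemma sum_frac_part_digit (R : realType) (b n k : nat) : (0 < b)%N ->
  \sum_(1 <= j < b) frac_part ((n%:R + j%:R * b%:R ^+ k) / b%:R ^+ k.+1 : R)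
  = (b%:R - 1) / 2
    - (frac_part (n%:R / b%:R ^+ k.+1) - frac_part (n%:R / b%:R ^+ k)).
Proof.
move=> b_gt0; have d_gt0 : (0 < b ^ k)%N by rewrite expn_gt0 b_gt0.
have bd_gt0 : (0 < b * b ^ k)%N by rewrite muln_gt0 b_gt0.
have := congr1 (GRing.natmul (1 : R)) (sum_modn_mulD n b_gt0 d_gt0).
(* The term [j = 0], absent from the goal, is split off; it becomes the subtracted fractional part
   of [n / b ^ k.+1]. *)
rewrite big_ltn // mul0n addn0 !natrD !natrM natr_sum => E.
have E2 : 'C(b, 2)%:R = b%:R * (b%:R - 1) / 2 :> R.
  apply: (canRL (mulfK _)); first by rewrite pnatr_eq0.
  by rewrite -natrM mulnC mul_bin_left bin1 natrM mulrC natrB.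
have b_neq0 : b%:R != 0 :> R by rewrite pnatr_eq0 -lt0n.
have d_neq0 : b%:R ^+ k != 0 :> R by rewrite expf_neq0.
under eq_bigr => j _ do
  rewrite -!natrX -natrM -natrD expnS frac_part_divn //.
rewrite -mulr_suml -!natrX expnS !frac_part_divn //.
rewrite natrM natrX in E *.
rewrite (canRL (addKr _) E) E2; field.
by rewrite b_neq0 d_neq0.
Qed.

(** Since [ln b > 0], the inequality reads [k * ln b <= ln n], and [ln] is increasing. Both the
    value of [m] and the range of the outer sum thus reduce to comparing integers. *)
Lemma le_log_base (R : realType) (b n k : nat) : (1 < b)%N -> (0 < n)%N ->
  (k%:R <= log_base b%:R n%:R :> R) = (b ^ k <= n)%N.
Proof.
move=> b_gt1 n_gt0; have b_gt0 : (0 < b)%N by exact: ltnW.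
rewrite /log_base ler_pdivlMr ?ln_gt0 ?ltr1n //.
rewrite mulr_natl -lnXn ?ltr0n // ler_ln ?posrE ?exprn_gt0 ?ltr0n //.
by rewrite -natrX ler_nat.
Qed.

Lemma floor_log_base (R : realType) (b n : nat) : (1 < b)%N -> (0 < n)%N ->
  Num.floor (log_base b%:R n%:R : R) = trunc_log b n.
Proof.
move=> b_gt1 n_gt0; apply: floor_def.
(* The two bounds defining the floor become [b ^ m <= n < b ^ m.+1] with [m = trunc_log b n]. *)
rewrite -PoszD addn1 -!pmulrn ltNge !le_log_base // -ltnNge.
exact: trunc_log_bounds.
Qed.

Theorem corollary8 (R : realType) (b n : nat) (hb : (2 <= b)%N) (hn : (0 < n)%N) :
  let m : int := Num.floor (log_base b%:R n%:R : R) in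
  \sum_(k \in [set k : nat | k%:R <= log_base b%:R n%:R :> R])
    \sum_(1 <= j < b) frac_part ((n%:R + j%:R * b%:R ^+ k) / b%:R ^+ k.+1 : R)
  = (m + 1)%:~R * ((b%:R - 1) / 2) - n%:R / b%:R ^ (m + 1).
Proof.
have b_gt0 : (0 < b)%N by exact: ltnW.
rewrite /= floor_log_base //; set m := trunc_log b n.
have -> : [set k : nat | k%:R <= log_base b%:R n%:R :> R] = `I_m.+1.
  apply/seteqP; split=> k /=; rewrite le_log_base // ltnS.
    exact: trunc_log_max.
  by move=> le_km; apply: leq_trans (trunc_logP hb hn); rewrite leq_pexp2l.
rewrite -fsbig_ord; under eq_bigr do rewrite sum_frac_part_digit //.
pose f k : R := frac_part (n%:R / b%:R ^+ k).
rewrite sumrB sumr_const card_ord -(big_mkord xpredT (fun k => f k.+1 - f k)).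
rewrite telescope_sumr // /f.
(* Only the end terms remain: [f 0] vanishes because [n] is an integer, and [f m.+1] is
   [n / b ^ m.+1] itself because [n < b ^ m.+1]. *)
rewrite -!natrX !frac_part_divn ?expn_gt0 ?b_gt0 // expn0 modn1 mul0r subr0.
rewrite modn_small ?trunc_log_ltn // -PoszD addn1 -exprnP -pmulrn.
by rewrite [_.+1%:R * _]mulr_natl natrX.
Qed.
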